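(* Let $L$ be the free Lie algebra over $\mathbb{C}$ on generators $a,b,c$, with $\mathfrak{sl}_2(\mathbb{C})$ acting on $L$ by derivations extending the adjoint representation on $L_1=\mathrm{span}\{a,b,c\}$. Then the space of Lie invariants of degree 7 (a subspace of $L_7$) has dimension 5 and the following basis $I_7^{(1)},\dots,I_7^{(5)}$: $$\begin{aligned} I_7^{(1)} &= 2[[[ca][ba]][[ca]c]] + [[[ca][ba]][[cb]b]] + 2[[[cb][ba]][[ba]c]] - [[[cb][ba]][[ca]b]] \\ &\quad - [[[cb][ca]][[ba]b]] - 2[[[cb][ca]][[ca]a]], \end{aligned}$$ $$\begin{aligned} I_7^{(2)} &= [[[ca][ba]][[cb]b]] + [[[cb][ba]][[ba]c]] - [[[cb][ba]][[ca]b]] - 2[[[cb][ca]][[ca]a]] \\ &\quad + [[[[ba]a][cb]][cb]] - [[[[ba]b][ca]][cb]] + 2[[[[ca]a][ca]][cb]] + [[[[ca]b][ba]][cb]] \\ &\quad - 2[[[[ca]b][ca]][ca]] + 2[[[[ca]c][ba]][ca]] - [[[[cb]b][ba]][ca]] + [[[[cb]c][ba]][ba]], \end{aligned}$$ $$\begin{aligned} I_7^{(3)} &= 2[[[ca][ba]][[ca]c]] - 2[[[ca][ba]][[cb]b]] + 3[[[cb][ba]][[ca]b]] - [[[cb][ca]][[ba]b]] \\ &\quad - [[[[ba]a]b][[cb]c]] + 2[[[[ba]a]c][[cb]b]] + [[[[ba]b]b][[ca]c]] - 3[[[[ba]b]c][[ca]b]] \\ &\quad + 2[[[[ba]c]c][[ba]b]]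 - 2[[[[ca]a]a][[cb]c]] + 2[[[[ca]a]b][[ca]c]] - [[[[ca]a]b][[cb]b]] \\ &\quad - 4[[[[ca]a]c][[ba]c]] + 2[[[[ca]a]c][[ca]b]] - [[[[ca]b]b][[ba]c]] + 2[[[[ca]b]b][[ca]b]] \\ &\quad - [[[[ca]b]c][[ba]b]] - 2[[[[ca]b]c][[ca]a]] + 2[[[[ca]c]c][[ba]a]] - [[[[cb]b]b][[ca]a]] \\ &\quad + [[[[cb]b]c][[ba]a]], \end{aligned}$$ $$\begin{aligned} I_7^{(4)} &= 8[[[ca][ba]][[ca]c]] - [[[ca][ba]][[cb]b]] + [[[cb][ba]][[ba]c]] + 5[[[cb][ba]][[ca]b]] \\ &\quad + 2[[[cb][ca]][[ca]a]] - 2[[[[ba]a]b][[cb]c]] - 8[[[[ba]a]c][[ca]c]] - [[[[ba]b]b][[cb]b]] \\ &\quad - 6[[[[ba]b]c][[ca]b]] - 8[[[[ba]c]c][[ca]a]] - 4[[[[ca]a]a][[cb]c]] + 4[[[[ca]a]b][[ca]c]] \\ &\quad - 2[[[[ca]a]b][[cb]b]] + 8[[[[ca]a]c][[ba]c]] - 4[[[[ca]a]c][[ca]b]] + 2[[[[ca]b]b][[ba]c]] \\ &\quad + 2[[[[ca]b]b][[ca]b]] + 2[[[[ca]b]c][[ba]b]] + 4[[[[ca]b]c][[ca]a]] + 4[[[[ca]c]c][[ba]a]] \\ &\quad + [[[[cb]b]b][[ba]b]] + 2[[[[cb]b]c][[ba]a]] + [[[[ba]a][cb]][cb]] - [[[[ba]b][ca]][cb]]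 \\ &\quad + 2[[[[ca]a][ca]][cb]] + [[[[ca]b][ba]][cb]] - 2[[[[ca]b][ca]][ca]] + 2[[[[ca]c][ba]][ca]] \\ &\quad - [[[[cb]b][ba]][ca]] + [[[[cb]c][ba]][ba]], \end{aligned}$$ $$\begin{aligned} I_7^{(5)} &= 2[[[ca][ba]][[cb]b]] - 8[[[cb][ba]][[ba]c]] + 2[[[cb][ba]][[ca]b]] - 6[[[cb][ca]][[ba]b]] \\ &\quad - 4[[[cb][ca]][[ca]a]] + 4[[[[ba]a][cb]][cb]] + 6[[[[ba]b][ca]][cb]] + 8[[[[ba]c][ba]][cb]] \\ &\quad + 32[[[[ba]c][ca]][ca]] + 12[[[[ca]a][ca]][cb]] - 12[[[[ca]b][ca]][ca]] - 20[[[[ca]c][ba]][ca]] \\ &\quad - 8[[[[cb]b][ba]][ca]] - 4[[[[cb]c][ba]][ba]] + 4[[[[[ba]a]b]c][cb]] + 16[[[[[ba]a]c]c][ca]] \\ &\quad + [[[[[ba]b]b]b][cb]] + 4[[[[[ba]b]b]c][ca]] + 4[[[[[ba]b]c]c][ba]] + 8[[[[[ca]a]a]c][cb]] \\ &\quad + 2[[[[[ca]a]b]b][cb]] - 8[[[[[ca]a]b]c][ca]] - 8[[[[[ca]a]c]c][ba]] - 2[[[[[ca]b]b]b][ca]] \\ &\quad - 6[[[[[ca]b]b]c][ba]] - [[[[[cb]b]b]b][ba]]. \end{aligned}$$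
   Context: $L=\bigoplus_{n\ge1}L_n$ is the grading of the free Lie algebra by degree (each generator has degree 1). $\mathfrak{sl}_2(\mathbb{C})$ has standard basis $x,h,y$ with $[h,x]=2x$, $[h,y]=-2y$, $[x,y]=h$. The space $L_1$ is regarded as the adjoint representation by identifying $a,b,c$ with $x,h,y$ respectively, so that $x.a=0$, $x.b=-2a$, $x.c=b$; $h.a=2a$, $h.b=0$, $h.c=-2c$; $y.a=-b$, $y.b=2c$, $y.c=0$. The action extends to all of $L$ by the derivation rule $D.[t,u]=[D.t,u]+[t,D.u]$ for $D\in\mathfrak{sl}_2(\mathbb{C})$. A Lie invariant of degree $j$ is an element $Z\in L_j$ with $D.Z=0$ for all $D\in\mathfrak{sl}_2(\mathbb{C})$. Commas are omitted in Lie brackets: $[uv]$ means $[u,v]$; e.g. $[[[ba]b][cb]]=[[[b,a],b],[c,b]]$. *)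

(* Defs.v *)
From HB Require Import structures.
From mathcomp Require Import all_boot all_order all_algebra.
From mathcomp Require Import boolp classical_sets reals complex.

Set Implicit Arguments.
Unset Strict Implicit.
Unset Printing Implicit Defensive.

Import GRing.Theory.
Local Open Scope ring_scope.
Local Open Scope classical_set_scope.

HB.mixin Record Lmodule_isLie (K : fieldType) L of GRing.Lmodule K L := {
  lie : L -> L -> L;
  lie_is_linearl : forall v : L, linear (lie^~ v);
  lie_is_linearr : forall u : L, linear (lie u);
  liexx : forall u : L, lie u u = 0;
  lie_jacobi : forall u v w : L,
    lie u (lie v w) + lie v (lie w u) + lie w (lie u v) = 0
}.

#[short(type="lieAlgType")]
HB.structure Definition LieAlg (K : fieldType) :=
  { L of Lmodule_isLie K L & GRing.Lmodule K L }.

Section LieAlgTheory.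
Variables (K : fieldType) (L : lieAlgType K).
Implicit Types u v w : L.

Lemma lieDl u v w : lie (u + v) w = lie u w + lie v w.
Proof. by have := lie_is_linearl w 1 u v; rewrite /= !scale1r. Qed.
Lemma lieDr u v w : lie u (v + w) = lie u v + lie u w.
Proof. by have := lie_is_linearr u 1 v w; rewrite !scale1r. Qed.
Lemma lie0l v : lie 0 v = 0.
Proof. by apply: (addrI (lie 0 v)); rewrite -lieDl !addr0. Qed.
Lemma lie0r u : lie u 0 = 0.
Proof. by apply: (addrI (lie u 0)); rewrite -lieDr !addr0. Qed.
Lemma lieZl k u v : lie (k *: u) v = k *: lie u v.
Proof. by have := lie_is_linearl v k u 0; rewrite /= !addr0 lie0l addr0. Qed.
Lemma lieZr k u v : lie u (k *: v) = k *: lie u v.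
Proof. by have := lie_is_linearr u k v 0; rewrite !addr0 lie0r addr0. Qed.
Lemma lieC u v : lie v u = - lie u v.
Proof.
apply/eqP; rewrite -addr_eq0; apply/eqP.
by have := liexx (v + u); rewrite lieDl !lieDr !liexx add0r addr0.
Qed.

Definition derivation (d : L -> L) : Prop :=
  linear d /\ forall u v, d (lie u v) = lie (d u) v + lie u (d v).

End LieAlgTheory.

Definition lie_hom (K : fieldType) (L M : lieAlgType K) (f : L -> M) : Prop :=
  linear f /\ forall u v, f (lie u v) = lie (f u) (f v).

(* The free Lie algebra is the algebra of formal linear and bracket
   expressions over the generators, modulo the congruence generated by the
   axioms of Lie algebras. *)
Section FreeLie.
Variables (K : fieldType) (X : Type).

Inductive lie_term : Type :=
| TGen of X
| TZero
| TAdd of lie_term & lie_term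
| TScale of K & lie_term
| TLie of lie_term & lie_term.

Inductive lie_eqv : lie_term -> lie_term -> Prop :=
| Eqv_refl s : lie_eqv s s
| Eqv_sym s t : lie_eqv s t -> lie_eqv t s
| Eqv_trans s t u : lie_eqv s t -> lie_eqv t u -> lie_eqv s u
| Eqv_add s s' t t' :
    lie_eqv s s' -> lie_eqv t t' -> lie_eqv (TAdd s t) (TAdd s' t')
| Eqv_scale k s s' : lie_eqv s s' -> lie_eqv (TScale k s) (TScale k s')
| Eqv_lie s s' t t' :
    lie_eqv s s' -> lie_eqv t t' -> lie_eqv (TLie s t) (TLie s' t')
| Eqv_addA s t u : lie_eqv (TAdd s (TAdd t u)) (TAdd (TAdd s t) u)
| Eqv_addC s t : lie_eqv (TAdd s t) (TAdd t s)
| Eqv_add0 s : lie_eqv (TAdd TZero s) s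
| Eqv_addN s : lie_eqv (TAdd (TScale (-1) s) s) TZero
| Eqv_scaleA k l s : lie_eqv (TScale k (TScale l s)) (TScale (k * l) s)
| Eqv_scale1 s : lie_eqv (TScale 1 s) s
| Eqv_scaleDr k s t :
    lie_eqv (TScale k (TAdd s t)) (TAdd (TScale k s) (TScale k t))
| Eqv_scaleDl k l s :
    lie_eqv (TScale (k + l) s) (TAdd (TScale k s) (TScale l s))
| Eqv_lieDl s t u : lie_eqv (TLie (TAdd s t) u) (TAdd (TLie s u) (TLie t u))
| Eqv_lieDr s t u : lie_eqv (TLie s (TAdd t u)) (TAdd (TLie s t) (TLie s u))
| Eqv_lieZl k s t : lie_eqv (TLie (TScale k s) t) (TScale k (TLie s t))
| Eqv_lieZr k s t : lie_eqv (TLie s (TScale k t)) (TScale k (TLie s t))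
| Eqv_liexx s : lie_eqv (TLie s s) TZero
| Eqv_jacobi s t u :
    lie_eqv (TAdd (TAdd (TLie s (TLie t u)) (TLie t (TLie u s)))
                  (TLie u (TLie s t))) TZero.

HB.instance Definition _ := gen_eqMixin lie_term.
HB.instance Definition _ := gen_choiceMixin lie_term.

Definition lie_eqvb (s t : lie_term) : bool := `[< lie_eqv s t >].

Lemma lie_eqvb_refl : reflexive lie_eqvb.
Proof. by move=> s; apply/asboolP/Eqv_refl. Qed.

Lemma lie_eqvb_sym : symmetric lie_eqvb.
Proof. by move=> s t; apply/asboolP/asboolP; apply: Eqv_sym. Qed.

Lemma lie_eqvb_trans : transitive lie_eqvb.
Proof.
by move=> t s u /asboolP st /asboolP tu; apply/asboolP/(Eqv_trans st tu).
Qed.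

Canonical lie_eqv_equiv := EquivRel lie_eqvb lie_eqvb_refl lie_eqvb_sym
  lie_eqvb_trans.

Definition freeLie : Type := {eq_quot lie_eqv_equiv}%qT.
HB.instance Definition _ := Choice.on freeLie.

Definition cls (s : lie_term) : freeLie := (\pi_({eq_quot lie_eqv_equiv}) s)%qT.
Definition rep (z : freeLie) : lie_term := @repr _ {eq_quot lie_eqv_equiv}%qT z.

Lemma repK : cancel rep cls.
Proof. exact: reprK. Qed.

Lemma clsP s t : cls s = cls t <-> lie_eqv s t.
Proof.
split=> [e|st]; last by apply/eqmodP/asboolP.
by apply/asboolP; apply/(@eqmodP _ lie_eqv_equiv).
Qed.

Lemma cls_rep s : lie_eqv (rep (cls s)) s.
Proof. by apply/clsP; rewrite repK. Qed.

Definition fl_gen (x : X) : freeLie := cls (TGen x).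
Definition fl_zero : freeLie := cls TZero.
Definition fl_add (u v : freeLie) : freeLie := cls (TAdd (rep u) (rep v)).
Definition fl_scale (k : K) (u : freeLie) : freeLie := cls (TScale k (rep u)).
Definition fl_opp (u : freeLie) : freeLie := fl_scale (-1) u.
Definition fl_lie (u v : freeLie) : freeLie := cls (TLie (rep u) (rep v)).

Lemma cls_add s t : fl_add (cls s) (cls t) = cls (TAdd s t).
Proof. by apply/clsP/Eqv_add; apply: cls_rep. Qed.
Lemma cls_scale k s : fl_scale k (cls s) = cls (TScale k s).
Proof. by apply/clsP/Eqv_scale/cls_rep. Qed.
Lemma cls_lie s t : fl_lie (cls s) (cls t) = cls (TLie s t).
Proof. by apply/clsP/Eqv_lie; apply: cls_rep. Qed.

Lemma fl_addA : associative fl_add.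
Proof.
move=> u v w; rewrite -(repK u) -(repK v) -(repK w) !cls_add.
exact/clsP/Eqv_addA.
Qed.
Lemma fl_addC : commutative fl_add.
Proof.
by move=> u v; rewrite -(repK u) -(repK v) !cls_add; apply/clsP/Eqv_addC.
Qed.
Lemma fl_add0 : left_id fl_zero fl_add.
Proof. by move=> u; rewrite -(repK u) cls_add; apply/clsP/Eqv_add0. Qed.
Lemma fl_addN : left_inverse fl_zero fl_opp fl_add.
Proof.
by move=> u; rewrite /fl_opp -(repK u) cls_scale cls_add; apply/clsP/Eqv_addN.
Qed.

HB.instance Definition _ :=
  GRing.isZmodule.Build freeLie fl_addA fl_addC fl_add0 fl_addN.

Lemma fl_scaleA k l u : fl_scale k (fl_scale l u) = fl_scale (k * l) u.
Proof. by rewrite -(repK u) !cls_scale; apply/clsP/Eqv_scaleA. Qed.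
Lemma fl_scale1 : left_id 1 fl_scale.
Proof. by move=> u; rewrite -(repK u) cls_scale; apply/clsP/Eqv_scale1. Qed.
Lemma fl_scaleDr : right_distributive fl_scale +%R.
Proof.
move=> k u v; rewrite -(repK u) -(repK v) /GRing.add /= cls_add !cls_scale.
by rewrite cls_add; apply/clsP/Eqv_scaleDr.
Qed.
Lemma fl_scaleDl u : {morph fl_scale^~ u : k l / k + l}.
Proof.
move=> k l; rewrite -(repK u) [in RHS]/GRing.add /= !cls_scale cls_add.
exact/clsP/Eqv_scaleDl.
Qed.

HB.instance Definition _ := GRing.Zmodule_isLmodule.Build K freeLie
  fl_scaleA fl_scale1 fl_scaleDr fl_scaleDl.

Lemma fl_addE u v : u + v = fl_add u v. Proof. by []. Qed.
Lemma fl_scaleE k (u : freeLie) : k *: u = fl_scale k u. Proof. by []. Qed.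

Lemma fl_lie_linl (v : freeLie) : linear (fl_lie^~ v).
Proof.
move=> k u w; rewrite -(repK u) -(repK v) -(repK w) !fl_addE !fl_scaleE.
rewrite !(cls_scale, cls_add, cls_lie); apply/clsP.
exact: Eqv_trans (Eqv_lieDl _ _ _) (Eqv_add (Eqv_lieZl _ _ _) (Eqv_refl _)).
Qed.
Lemma fl_lie_linr (u : freeLie) : linear (fl_lie u).
Proof.
move=> k v w; rewrite -(repK u) -(repK v) -(repK w) !fl_addE !fl_scaleE.
rewrite !(cls_scale, cls_add, cls_lie); apply/clsP.
exact: Eqv_trans (Eqv_lieDr _ _ _) (Eqv_add (Eqv_lieZr _ _ _) (Eqv_refl _)).
Qed.
Lemma fl_liexx u : fl_lie u u = 0.
Proof. by rewrite -(repK u) cls_lie; apply/clsP/Eqv_liexx. Qed.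
Lemma fl_jacobi u v w :
  fl_lie u (fl_lie v w) + fl_lie v (fl_lie w u) + fl_lie w (fl_lie u v) = 0.
Proof.
rewrite -(repK u) -(repK v) -(repK w) !cls_lie !fl_addE !cls_add.
exact/clsP/Eqv_jacobi.
Qed.

HB.instance Definition _ := Lmodule_isLie.Build K freeLie
  fl_lie_linl fl_lie_linr fl_liexx fl_jacobi.

Lemma clsD s t : cls (TAdd s t) = cls s + cls t.
Proof. by rewrite fl_addE cls_add. Qed.
Lemma clsZ k s : cls (TScale k s) = k *: cls s.
Proof. by rewrite fl_scaleE cls_scale. Qed.
Lemma clsL s t : cls (TLie s t) = lie (cls s) (cls t).
Proof. by rewrite -cls_lie. Qed.

Lemma freeLie_ind (P : freeLie -> Prop) :
    (forall x, P (fl_gen x)) -> P 0 ->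
    (forall u v, P u -> P v -> P (u + v)) ->
    (forall k u, P u -> P (k *: u)) ->
    (forall u v, P u -> P v -> P (lie u v)) ->
  forall z, P z.
Proof.
move=> Pg P0 PD PZ PL z; rewrite -(repK z).
elim: (rep z) => [x||s Ps t Pt|k s Ps|s Ps t Pt].
- exact: Pg.
- exact: P0.
- by rewrite clsD; apply: PD.
- by rewrite clsZ; apply: PZ.
- by rewrite clsL; apply: PL.
Qed.

Section Extension.
Variables (M : lieAlgType K) (g : X -> M).

Fixpoint ext_term (s : lie_term) : M :=
  match s with
  | TGen x => g x
  | TZero => 0
  | TAdd s t => ext_term s + ext_term t
  | TScale k s => k *: ext_term s
  | TLie s t => lie (ext_term s) (ext_term t)
  end.

Lemma ext_term_eqv s t : lie_eqv s t -> ext_term s = ext_term t.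
Proof.
elim=> //=; try by move=> *; congruence.
- by move=> *; rewrite addrA.
- by move=> *; rewrite addrC.
- by move=> *; rewrite add0r.
- by move=> *; rewrite scaleN1r addNr.
- by move=> *; rewrite scalerA.
- by move=> *; rewrite scale1r.
- by move=> *; rewrite scalerDr.
- by move=> *; rewrite scalerDl.
- by move=> *; rewrite lieDl.
- by move=> *; rewrite lieDr.
- by move=> *; rewrite lieZl.
- by move=> *; rewrite lieZr.
- by move=> *; rewrite liexx.
- by move=> *; rewrite lie_jacobi.
Qed.

Definition fl_ext (z : freeLie) : M := ext_term (rep z).

Lemma fl_ext_cls s : fl_ext (cls s) = ext_term s.
Proof. exact/ext_term_eqv/cls_rep. Qed.

End Extension.

Theorem freeLie_universal (M : lieAlgType K) (g : X -> M) :
  exists! f : freeLie -> M, lie_hom f /\ forall x, f (fl_gen x) = g x.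
Proof.
exists (fl_ext g); split.
  split; last by move=> x; rewrite fl_ext_cls.
  split=> [k u v|u v]; rewrite -(repK u) -(repK v).
    by rewrite -clsZ -clsD !fl_ext_cls.
  by rewrite -clsL !fl_ext_cls.
move=> f [[flin flie] fg]; apply/funext => z; rewrite -(repK z) fl_ext_cls.
have f0 : f 0 = 0.
  by have := flin (-1) 0 0; rewrite scaler0 addr0 scaleN1r addNr.
elim: (rep z) => [x||s IHs t IHt|k s IHs|s IHs t IHt] //=.
- by rewrite fg.
- by rewrite clsD -(scale1r (cls s)) flin scale1r -IHs -IHt.
- by rewrite clsZ -[_ *: cls s]addr0 flin f0 addr0 -IHs.
- by rewrite clsL flie -IHs -IHt.
Qed.

Section Derivation.
Variable g : X -> freeLie.

Fixpoint der_term (s : lie_term) : freeLie :=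
  match s with
  | TGen x => g x
  | TZero => 0
  | TAdd s t => der_term s + der_term t
  | TScale k s => k *: der_term s
  | TLie s t => lie (der_term s) (cls t) + lie (cls s) (der_term t)
  end.

Lemma der_term_eqv s t : lie_eqv s t -> der_term s = der_term t.
Proof.
elim=> //=; try by move=> *; congruence.
- by move=> s0 s' t0 t' /clsP -> -> /clsP -> ->.
- by move=> *; rewrite addrA.
- by move=> *; rewrite addrC.
- by move=> *; rewrite add0r.
- by move=> *; rewrite scaleN1r addNr.
- by move=> *; rewrite scalerA.
- by move=> *; rewrite scale1r.
- by move=> *; rewrite scalerDr.
- by move=> *; rewrite scalerDl.
- by move=> *; rewrite !clsD !lieDl addrACA.
- by move=> *; rewrite !clsD !lieDr addrACA.
- by move=> *; rewrite !clsZ !lieZl -scalerDr.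
- by move=> *; rewrite !clsZ !lieZr -scalerDr.
- by move=> s0; rewrite lieC addNr.
- move=> x y z; rewrite !clsL !lieDr.
  rewrite (AC ((1*2)*(1*2)*(1*2)) ((1*6*8)*(2*4*9)*(3*5*7)))/=.
  by rewrite !lie_jacobi !addr0.
Qed.

Definition fl_der (z : freeLie) : freeLie := der_term (rep z).

Lemma fl_der_cls s : fl_der (cls s) = der_term s.
Proof. exact/der_term_eqv/cls_rep. Qed.

Lemma fl_der_gen x : fl_der (fl_gen x) = g x.
Proof. exact: fl_der_cls. Qed.

Lemma fl_der_derivation : derivation fl_der.
Proof.
split=> [k u v|u v]; rewrite -(repK u) -(repK v).
  by rewrite -clsZ -clsD !fl_der_cls.
by rewrite -clsL !fl_der_cls.
Qed.

Lemma fl_der_unique (d : freeLie -> freeLie) :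
  derivation d -> (forall x, d (fl_gen x) = g x) -> d = fl_der.
Proof.
move=> [dlin dlie] dg; apply/funext => z; rewrite -(repK z) fl_der_cls.
have d0 : d 0 = 0.
  by have := dlin (-1) 0 0; rewrite scaler0 addr0 scaleN1r addNr.
elim: (rep z) => [x||s IHs t IHt|k s IHs|s IHs t IHt] //=.
- by rewrite dg.
- by rewrite clsD -(scale1r (cls s)) dlin scale1r -IHs -IHt.
- by rewrite clsZ -[_ *: cls s]addr0 dlin d0 addr0 -IHs.
- by rewrite clsL dlie -IHs -IHt.
Qed.

End Derivation.

(* L_n, the span of the n-fold bracket monomials in the generators; the
   component of degree 0 is zero. *)
Inductive fl_homog : nat -> set freeLie :=
| Homog_gen x : fl_homog 1 (fl_gen x)
| Homog_lie m n u v : fl_homog m u -> fl_homog n v -> fl_homog (m + n) (lie u v)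
| Homog_0 n : fl_homog n 0
| Homog_add n u v : fl_homog n u -> fl_homog n v -> fl_homog n (u + v)
| Homog_scale n k u : fl_homog n u -> fl_homog n (k *: u).

End FreeLie.

Section Basis.
Variables (K : fieldType) (V : lmodType K).

Definition is_basis (S : set V) (n : nat) (e : n.-tuple V) : Prop :=
  (forall k : 'I_n -> K,
     \sum_(i < n) k i *: tnth e i = 0 -> forall i, k i = 0) /\
  S = [set v | exists k : 'I_n -> K, v = \sum_(i < n) k i *: tnth e i].

Definition has_dim (S : set V) (n : nat) : Prop :=
  exists e : n.-tuple V, is_basis S e.

End Basis.

Inductive abc := ga | gb | gc.

Section Invariants.
Variable R : realType.
Local Notation C := R[i].
Local Notation L := (freeLie C abc).
Local Notation a := (fl_gen C ga : L).
Local Notation b := (fl_gen C gb : L).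
Local Notation c := (fl_gen C gc : L).

Definition sl2 : set 'M[C]_2 := [set D | \tr D = 0].

Definition sl2x : 'M[C]_2 := delta_mx 0 1.
Definition sl2h : 'M[C]_2 := delta_mx 0 0 - delta_mx 1 1.
Definition sl2y : 'M[C]_2 := delta_mx 1 0.

Definition mxcomm (A B : 'M[C]_2) : 'M[C]_2 := A *m B - B *m A.

(* The identification of a, b, c with x, h, y, and its inverse
   alpha x + beta h + gamma y |-> alpha a + beta b + gamma c. *)
Definition gen_sl2 (g : abc) : 'M[C]_2 :=
  match g with ga => sl2x | gb => sl2h | gc => sl2y end.

Definition sl2_gen (M : 'M[C]_2) : L := M 0 1 *: a + M 0 0 *: b + M 1 0 *: c.

Definition act (D : 'M[C]_2) : L -> L :=
  fl_der (fun g => sl2_gen (mxcomm D (gen_sl2 g))).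

Definition lie_invariant (n : nat) : set L :=
  [set Z | fl_homog n Z /\ forall D, sl2 D -> act D Z = 0].

Lemma mxcommE (A B : 'M[C]_2) i j : mxcomm A B i j =
  A i 0 * B 0 j + A i 1 * B 1 j - (B i 0 * A 0 j + B i 1 * A 1 j).
Proof.
have E1 : lift ord0 ord0 = 1 :> 'I_2 by apply/val_inj.
by rewrite !mxE !big_ord_recl !big_ord0 !addr0 !E1.
Qed.

Lemma mx2P (A B : 'M[C]_2) :
  A 0 0 = B 0 0 -> A 0 1 = B 0 1 -> A 1 0 = B 1 0 -> A 1 1 = B 1 1 -> A = B.
Proof.
move=> e00 e01 e10 e11; apply/matrixP => i j.
have ord2 (k : 'I_2) : k = 0 \/ k = 1.
  by case: k => [[|[|//]] ?]; [left|right]; apply/val_inj.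
by case: (ord2 i) => ->; case: (ord2 j) => ->.
Qed.

Local Ltac sl2_simp := rewrite ?(mxcommE, mxE) /=
  ?(mulr0n, mulr1n, mulr0, mul0r, mulr1, mul1r, subr0, sub0r, oppr0, addr0,
    add0r, mulrN, mulNr, opprK, scale0r, scale1r, scaleN1r).

Lemma sl2_span D : sl2 D -> D = D 0 1 *: sl2x + D 0 0 *: sl2h + D 1 0 *: sl2y.
Proof.
rewrite /sl2 /= /mxtrace !big_ord_recl big_ord0 addr0.
have -> : lift ord0 ord0 = 1 :> 'I_2 by apply/val_inj.
by move/eqP; rewrite addrC addr_eq0 => /eqP D11; apply: mx2P; sl2_simp.
Qed.

Lemma sl2_hx : mxcomm sl2h sl2x = 2 *: sl2x.
Proof. by apply: mx2P; sl2_simp. Qed.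
Lemma sl2_hy : mxcomm sl2h sl2y = - 2 *: sl2y.
Proof. by apply: mx2P; sl2_simp; rewrite -?opprD. Qed.
Lemma sl2_xy : mxcomm sl2x sl2y = sl2h.
Proof. by apply: mx2P; sl2_simp. Qed.

Lemma act_derivation D : derivation (act D).
Proof. exact: fl_der_derivation. Qed.

Local Ltac act_simp := rewrite /act fl_der_gen /sl2_gen; sl2_simp;
  rewrite -?opprD ?subrr ?scale0r.

Lemma act_xa : act sl2x a = 0.
Proof. by act_simp. Qed.
Lemma act_xb : act sl2x b = - 2 *: a.
Proof. by act_simp. Qed.
Lemma act_xc : act sl2x c = b.
Proof. by act_simp. Qed.
Lemma act_ha : act sl2h a = 2 *: a.
Proof. by act_simp. Qed.
Lemma act_hb : act sl2h b = 0.
Proof. by act_simp. Qed.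
Lemma act_hc : act sl2h c = - 2 *: c.
Proof. by act_simp. Qed.
Lemma act_ya : act sl2y a = - b.
Proof. by act_simp. Qed.
Lemma act_yb : act sl2y b = 2 *: c.
Proof. by act_simp. Qed.
Lemma act_yc : act sl2y c = 0.
Proof. by act_simp. Qed.

End Invariants.

Arguments lie_invariant : clear implicits.

(* $[[c a]b] is the iterated bracket [[c, a], b]. *)
Declare Custom Entry lie.
Local Notation "$ e" := e (at level 0, e custom lie at level 0).
Local Notation "[ u v ]" := (lie u v)
  (in custom lie at level 0, u custom lie, v custom lie).
Local Notation "x" := x (in custom lie at level 0, x ident).

Section Elements.
Variables (K : fieldType) (L : lieAlgType K) (a b c : L).

Definition I7_1 : L :=
    2 *: $[[[c a][b a]][[c a]c]]
  + $[[[c a][b a]][[c b]b]]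
  + 2 *: $[[[c b][b a]][[b a]c]]
  - $[[[c b][b a]][[c a]b]]
  - $[[[c b][c a]][[b a]b]]
  - 2 *: $[[[c b][c a]][[c a]a]].

Definition I7_2 : L :=
    $[[[c a][b a]][[c b]b]]
  + $[[[c b][b a]][[b a]c]]
  - $[[[c b][b a]][[c a]b]]
  - 2 *: $[[[c b][c a]][[c a]a]]
  + $[[[[b a]a][c b]][c b]]
  - $[[[[b a]b][c a]][c b]]
  + 2 *: $[[[[c a]a][c a]][c b]]
  + $[[[[c a]b][b a]][c b]]
  - 2 *: $[[[[c a]b][c a]][c a]]
  + 2 *: $[[[[c a]c][b a]][c a]]
  - $[[[[c b]b][b a]][c a]]
  + $[[[[c b]c][b a]][b a]].

Definition I7_3 : L :=
    2 *: $[[[c a][b a]][[c a]c]]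
  - 2 *: $[[[c a][b a]][[c b]b]]
  + 3 *: $[[[c b][b a]][[c a]b]]
  - $[[[c b][c a]][[b a]b]]
  - $[[[[b a]a]b][[c b]c]]
  + 2 *: $[[[[b a]a]c][[c b]b]]
  + $[[[[b a]b]b][[c a]c]]
  - 3 *: $[[[[b a]b]c][[c a]b]]
  + 2 *: $[[[[b a]c]c][[b a]b]]
  - 2 *: $[[[[c a]a]a][[c b]c]]
  + 2 *: $[[[[c a]a]b][[c a]c]]
  - $[[[[c a]a]b][[c b]b]]
  - 4 *: $[[[[c a]a]c][[b a]c]]
  + 2 *: $[[[[c a]a]c][[c a]b]]
  - $[[[[c a]b]b][[b a]c]]
  + 2 *: $[[[[c a]b]b][[c a]b]]
  - $[[[[c a]b]c][[b a]b]]
  - 2 *: $[[[[c a]b]c][[c a]a]]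
  + 2 *: $[[[[c a]c]c][[b a]a]]
  - $[[[[c b]b]b][[c a]a]]
  + $[[[[c b]b]c][[b a]a]].

Definition I7_4 : L :=
    8 *: $[[[c a][b a]][[c a]c]]
  - $[[[c a][b a]][[c b]b]]
  + $[[[c b][b a]][[b a]c]]
  + 5 *: $[[[c b][b a]][[c a]b]]
  + 2 *: $[[[c b][c a]][[c a]a]]
  - 2 *: $[[[[b a]a]b][[c b]c]]
  - 8 *: $[[[[b a]a]c][[c a]c]]
  - $[[[[b a]b]b][[c b]b]]
  - 6 *: $[[[[b a]b]c][[c a]b]]
  - 8 *: $[[[[b a]c]c][[c a]a]]
  - 4 *: $[[[[c a]a]a][[c b]c]]
  + 4 *: $[[[[c a]a]b][[c a]c]]
  - 2 *: $[[[[c a]a]b][[c b]b]]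
  + 8 *: $[[[[c a]a]c][[b a]c]]
  - 4 *: $[[[[c a]a]c][[c a]b]]
  + 2 *: $[[[[c a]b]b][[b a]c]]
  + 2 *: $[[[[c a]b]b][[c a]b]]
  + 2 *: $[[[[c a]b]c][[b a]b]]
  + 4 *: $[[[[c a]b]c][[c a]a]]
  + 4 *: $[[[[c a]c]c][[b a]a]]
  + $[[[[c b]b]b][[b a]b]]
  + 2 *: $[[[[c b]b]c][[b a]a]]
  + $[[[[b a]a][c b]][c b]]
  - $[[[[b a]b][c a]][c b]]
  + 2 *: $[[[[c a]a][c a]][c b]]
  + $[[[[c a]b][b a]][c b]]
  - 2 *: $[[[[c a]b][c a]][c a]]
  + 2 *: $[[[[c a]c][b a]][c a]]
  - $[[[[c b]b][b a]][c a]]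
  + $[[[[c b]c][b a]][b a]].

Definition I7_5 : L :=
    2 *: $[[[c a][b a]][[c b]b]]
  - 8 *: $[[[c b][b a]][[b a]c]]
  + 2 *: $[[[c b][b a]][[c a]b]]
  - 6 *: $[[[c b][c a]][[b a]b]]
  - 4 *: $[[[c b][c a]][[c a]a]]
  + 4 *: $[[[[b a]a][c b]][c b]]
  + 6 *: $[[[[b a]b][c a]][c b]]
  + 8 *: $[[[[b a]c][b a]][c b]]
  + 32 *: $[[[[b a]c][c a]][c a]]
  + 12 *: $[[[[c a]a][c a]][c b]]
  - 12 *: $[[[[c a]b][c a]][c a]]
  - 20 *: $[[[[c a]c][b a]][c a]]
  - 8 *: $[[[[c b]b][b a]][c a]]
  - 4 *: $[[[[c b]c][b a]][b a]]
  + 4 *: $[[[[[b a]a]b]c][c b]]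
  + 16 *: $[[[[[b a]a]c]c][c a]]
  + $[[[[[b a]b]b]b][c b]]
  + 4 *: $[[[[[b a]b]b]c][c a]]
  + 4 *: $[[[[[b a]b]c]c][b a]]
  + 8 *: $[[[[[c a]a]a]c][c b]]
  + 2 *: $[[[[[c a]a]b]b][c b]]
  - 8 *: $[[[[[c a]a]b]c][c a]]
  - 8 *: $[[[[[c a]a]c]c][b a]]
  - 2 *: $[[[[[c a]b]b]b][c a]]
  - 6 *: $[[[[[c a]b]b]c][b a]]
  - $[[[[[c b]b]b]b][b a]].

Definition I7_elements : 5.-tuple L := [tuple I7_1; I7_2; I7_3; I7_4; I7_5].

End Elements.

Definition I7 (R : realType) : 5.-tuple (freeLie R[i] abc) :=
  I7_elements (fl_gen R[i] ga) (fl_gen R[i] gb) (fl_gen R[i] gc).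

(* Main.v *)
Require Import Defs.
From HB Require Import structures.
From Stdlib Require Import ZArith.
From mathcomp Require Import all_boot all_order all_algebra.
From mathcomp Require Import boolp classical_sets functions reals complex.
From mathcomp Require Import ring ssrZ.

(** The free Lie algebra $L$ is compared with the noncommutative series in the
    generators: [expand] sends a Lie element to the series it becomes when
    every bracket is replaced by a commutator.  The Dynkin operator, which
    sends a word $w_1 \cdots w_n$ to the left-normed bracket
    $[w] = [\ldots[w_1, w_2], \ldots, w_n]$, satisfies $D(\mathrm{expand}(v))
    = n v$ for every $v \in L_n$ ([dynkin_expand]).  This has two consequences
    in characteristic zero: [expand] is injective on $L_n$ ([expand_inj]), so
    that an identity in $L_n$ can be verified on the coefficients of two
    noncommutative polynomials; and each $Z \in L_7$ is $1/7$ times the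
    combination of the brackets $[w]$ whose coefficients are those of the
    series of $Z$.

    Invariance of the five elements is then a computation with integer
    polynomials: the derivations $x$, $h$, $y$ kill their expansions
    ([I7_invariant]).  Their independence is seen on the coefficients of five
    words, whose $5 \times 5$ matrix is unimodular; [dual_functionals] is its
    inverse ([I7_dual]).

    That nothing else is invariant uses the extremal projector
    $P = \sum_n \frac{(-1)^n}{n!(n+1)!} y^n x^n$ of $sl_2$.  In a finite
    dimensional module, $P$ maps the weight zero space onto the invariants;
    in $L_7$ the terms with $n > 6$ vanish there because every weight is at
    most $12$.  If $Z$ is invariant, then $xZ = 0$ gives $PZ = Z$, and $hZ = 0$
    says that only words of weight zero occur in the series of $Z$.  Hence $Z$
    is a combination of the elements $P[w]$ with $w$ of weight zero, and it
    remains to find each of these in the span of the five given elements.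
    This is a finite computation ([check_span_true]): the only possible
    coefficients are the values of the dual functionals, and the difference
    must expand to the zero polynomial.  By antisymmetry of the first bracket
    it suffices to treat the words that begin with $ba$, $ca$ or $cb$. *)

Set Implicit Arguments.
Unset Strict Implicit.
Unset Printing Implicit Defensive.

Import Order.TTheory GRing.Theory Num.Theory.
Local Open Scope ring_scope.

(** * Noncommutative power series *)

Section Series.
Variables (K : fieldType) (X : finType).

Definition series : Type := seq X -> K.
HB.instance Definition _ := GRing.Lmodule.copy series (seq X -> K^o).

Implicit Types (f g h : series) (w u : seq X) (x y : X).

Lemma seriesD f g w : (f + g) w = f w + g w. Proof. by []. Qed.
Lemma seriesN f w : (- f) w = - f w. Proof. by []. Qed.
Lemma seriesZ k f w : (k *: f) w = k * f w. Proof. by []. Qed.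

Lemma series_sumE (F : X -> series) w : (\sum_x F x) w = \sum_x F x w.
Proof. exact: (big_morph (fun f : series => f w)). Qed.

(** A series is its constant term together with its left quotients by the
    letters; all operations below are defined, and all identities proved, by
    recursion on words through this decomposition. *)
Definition lquo x f : series := fun u => f (x :: u).

(** The Cauchy product, in the form
    $x^{-1}(f g) = f_1\, x^{-1} g + (x^{-1} f) g$, where $f_1$ is the constant
    term. *)
Fixpoint smul_at f g w : K :=
  if w is x :: u then f [::] * g w + smul_at (lquo x f) g u
  else f [::] * g [::].
Definition smul f g : series := smul_at f g.

Lemma smul_consE f g x u :
  smul f g (x :: u) = f [::] * g (x :: u) + smul (lquo x f) g u.
Proof. by []. Qed.

Lemma lquo_smul x f g :
  lquo x (smul f g) = f [::] *: lquo x g + smul (lquo x f) g.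
Proof. by []. Qed.

Lemma smulPl k f g h w : smul (k *: f + g) h w = k * smul f h w + smul g h w.
Proof.
elim: w f g => [|x u IH] f g.
  by rewrite /smul /= seriesD seriesZ; ring.
rewrite !smul_consE (_ : lquo x _ = k *: lquo x f + lquo x g) // IH.
by rewrite seriesD seriesZ; ring.
Qed.

Lemma smulPr k f g h w : smul f (k *: g + h) w = k * smul f g w + smul f h w.
Proof.
elim: w f => [|x u IH] f.
  by rewrite /smul /= seriesD seriesZ; ring.
by rewrite !smul_consE IH seriesD seriesZ; ring.
Qed.

Lemma smul0l g w : smul 0 g w = 0.
Proof.
elim: w => [|x u IH]; first by rewrite /smul /= mul0r.
by rewrite smul_consE mul0r add0r.
Qed.

Lemma smulZl k f g w : smul (k *: f) g w = k * smul f g w.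
Proof. by rewrite -[_ *: _]addr0 smulPl smul0l addr0. Qed.

Lemma smul_suml (F : X -> series) g w :
  smul (\sum_x F x) g w = \sum_x smul (F x) g w.
Proof.
apply: (big_morph (fun f => smul f g w)); last exact: smul0l.
by move=> f h; rewrite -[f]scale1r smulPl mul1r scale1r.
Qed.

Lemma smulA f g h : smul (smul f g) h = smul f (smul g h).
Proof.
apply/funext => w; elim: w f => [|x u IH] f; first by rewrite /smul /=; ring.
by rewrite !smul_consE lquo_smul smulPl IH; rewrite /smul /=; ring.
Qed.

Definition slie f g : series := smul f g - smul g f.

Lemma slieE f g w : slie f g w = smul f g w - smul g f w. Proof. by []. Qed.

Lemma slie_linl h : linear (slie^~ h).
Proof.
move=> k f g; apply/funext => w.
by rewrite seriesD seriesZ !slieE smulPl smulPr; ring.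
Qed.

Lemma slie_linr h : linear (slie h).
Proof.
move=> k f g; apply/funext => w.
by rewrite seriesD seriesZ !slieE smulPl smulPr; ring.
Qed.

Lemma sliexx f : slie f f = 0.
Proof. exact: subrr. Qed.

Lemma slie_jacobi f g h :
  slie f (slie g h) + slie g (slie h f) + slie h (slie f g) = 0.
Proof.
have E f' g' h' w : slie f' (slie g' h') w =
    smul f' (smul g' h') w - smul f' (smul h' g') w
    - (smul g' (smul h' f') w - smul h' (smul g' f') w).
  rewrite slieE /slie; set p := smul g' h'; set q := smul h' g'.
  have -> : p - q = (-1) *: q + p by rewrite addrC scaleN1r.
  by rewrite smulPl smulPr /p /q !smulA; ring.
apply/funext => w; rewrite !seriesD !E.
have -> : (0 : series) w = 0 by [].
ring.
Qed.

HB.instance Definition _ := Lmodule_isLie.Build K series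
  slie_linl slie_linr sliexx slie_jacobi.

Lemma lie_seriesE f g : lie f g = slie f g. Proof. by []. Qed.

Definition sone : series := fun w => (w == [::])%:R.
Definition letter x : series := fun w => (w == [:: x])%:R.

Lemma letter_cons x y u : letter x (y :: u) = (y == x)%:R * (u == [::])%:R.
Proof. by rewrite /letter eqseq_cons -natrM mulnb. Qed.

Lemma lquo_letter x y : lquo y (letter x) = (y == x)%:R *: sone.
Proof. by apply/funext => v; rewrite /lquo letter_cons seriesZ. Qed.

Definition series_homog n f := forall w, size w != n -> f w = 0.

Lemma lquo_homog n f x : series_homog n.+1 f -> series_homog n (lquo x f).
Proof. by move=> hf w sw; apply: hf. Qed.

Lemma smul_homog m n f g :
  series_homog m f -> series_homog n g -> series_homog (m + n) (smul f g).
Proof.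
move=> hf hg w; elim: w m f hf => [|x u IH] [|m] f hf sw.
- by rewrite /smul /= (hg [::]) // mulr0.
- by rewrite /smul /= (hf [::]) // mul0r.
- rewrite smul_consE (hg (x :: u)) // mulr0 add0r.
  rewrite (_ : lquo x f = 0) ?smul0l //.
  by apply/funext => v; apply: hf.
- rewrite smul_consE (hf [::]) // mul0r add0r.
  by apply: (IH m) => //; apply: lquo_homog.
Qed.

(** * Derivations of series given by a matrix on the letters *)

Section Derivation.
Variable A : X -> X -> K.

(** The derivation with $y \mapsto \sum_x A_{yx} x$ on letters: the coefficient
    of $x u$ in its value comes either from changing a letter of $u$, or from
    changing the first letter $y$ of a word $y u$ to $x$. *)
Fixpoint sder_at f w : K :=
  if w is x :: u then
    sder_at (lquo x f) u + \sum_(y : X) A y x * f (y :: u)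
  else 0.
Definition sder f : series := sder_at f.

Lemma sder_nil f : sder f [::] = 0. Proof. by []. Qed.

Lemma sder_consE f x u :
  sder f (x :: u) = sder (lquo x f) u + \sum_(y : X) A y x * f (y :: u).
Proof. by []. Qed.

Lemma lquo_sder x f :
  lquo x (sder f) = sder (lquo x f) + \sum_(y : X) A y x *: lquo y f.
Proof.
by apply/funext => u; rewrite seriesD series_sumE; apply: sder_consE.
Qed.

Lemma sder_linear : linear sder.
Proof.
move=> k f g; apply/funext => w; rewrite seriesD seriesZ.
elim: w f g => [|x u IH] f g; first by rewrite /sder /=; ring.
rewrite !sder_consE (_ : lquo x _ = k *: lquo x f + lquo x g) // IH.
under eq_bigr do rewrite seriesD seriesZ mulrDr mulrCA.
by rewrite big_split /= -mulr_sumr; ring.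
Qed.
HB.instance Definition _ := GRing.isLinear.Build K series series _ sder
  sder_linear.

Lemma sder_smul f g : sder (smul f g) = smul (sder f) g + smul f (sder g).
Proof.
apply/funext => w; rewrite seriesD.
elim: w f => [|x u IH] f; first by rewrite /smul /sder /=; ring.
rewrite sder_consE lquo_smul sder_linear seriesD seriesZ IH !smul_consE.
rewrite lquo_sder -[sder (lquo x f)]scale1r smulPl smul_suml scale1r.
rewrite sder_consE sder_nil.
under eq_bigr do rewrite smul_consE mulrDr mulrCA.
under [X in _ = _ + (1 * _ + X) + _]eq_bigr do rewrite smulZl.
by rewrite big_split /= -mulr_sumr; ring.
Qed.

Lemma sder_slie f g : sder (slie f g) = slie (sder f) g + slie f (sder g).
Proof.
rewrite linearB /= !sder_smul; apply/funext => w.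
by rewrite !(seriesD, seriesN, slieE); ring.
Qed.

Lemma sder_sone : sder sone = 0.
Proof.
apply/funext => -[|x u] //.
rewrite sder_consE (_ : lquo x sone = 0) // linear0.
by rewrite add0r big1 // => y _; rewrite mulr0.
Qed.

Lemma sder_letter x : sder (letter x) = \sum_y A x y *: letter y.
Proof.
apply/funext => w; rewrite series_sumE.
under eq_bigr do rewrite seriesZ.
case: w => [|y u]; first by rewrite big1 // => y _; rewrite mulr0.
rewrite sder_consE.
under eq_bigr do rewrite letter_cons mulrA.
under [in LHS]eq_bigr do rewrite letter_cons mulrA.
rewrite -!mulr_suml.
have pick (F : X -> K) z : \sum_t F t * (z == t)%:R = F z.
  rewrite (bigD1 z) //= eqxx mulr1 big1 ?addr0 // => t.
  by rewrite eq_sym => /negbTE ->; rewrite mulr0.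
rewrite pick (eq_bigr (fun t => A t y * (x == t)%:R)); last first.
  by move=> t _; rewrite eq_sym.
rewrite pick -[RHS]add0r; congr (_ + _).
by rewrite lquo_letter linearZ /= sder_sone scaler0.
Qed.

End Derivation.

End Series.

(** * Expansion of Lie elements and the Dynkin operator *)

Section Expansion.
Variables (K : fieldType) (X : finType).
Implicit Types (f g : series K X) (x y : X) (A : X -> X -> K).
Local Notation series := (series K X).
Local Notation letter := (@letter K X).
Local Notation sone := (@sone K X).
Local Notation L := (freeLie K X).
Local Notation gen := (@fl_gen K X).

Definition expand : L -> series := fl_ext letter.

Lemma expand_lie_hom : lie_hom expand.
Proof.
split=> [k u v|u v]; rewrite -(repK u) -(repK v) /expand.
  by rewrite -clsZ -clsD !fl_ext_cls.
by rewrite -clsL !fl_ext_cls.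
Qed.

HB.instance Definition _ := GRing.isLinear.Build K L series _ expand
  expand_lie_hom.1.

Lemma expand_gen x : expand (gen x) = letter x.
Proof. exact: fl_ext_cls. Qed.

Lemma expandL u v : expand (lie u v) = lie (expand u) (expand v).
Proof. exact: expand_lie_hom.2. Qed.

Definition matrix_der A : L -> L := fl_der (fun y => \sum_x A y x *: gen x).

HB.instance Definition _ A := GRing.isLinear.Build K L L _ (matrix_der A)
  (fl_der_derivation (fun y => \sum_x A y x *: gen x)).1.

Lemma matrix_derL A u v :
  matrix_der A (lie u v) = lie (matrix_der A u) v + lie u (matrix_der A v).
Proof. exact: (fl_der_derivation _).2. Qed.

Lemma expand_matrix_der A z : expand (matrix_der A z) = sder A (expand z).
Proof.
elim/freeLie_ind: z => [x||u v Eu Ev|k u Eu|u v Eu Ev].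
- rewrite /matrix_der fl_der_gen linear_sum expand_gen sder_letter.
  by apply: eq_bigr => y _; rewrite linearZ /= expand_gen.
- by rewrite !linear0.
- by rewrite !linearD /= Eu Ev.
- by rewrite !linearZ /= Eu.
- by rewrite matrix_derL linearD /= !expandL Eu Ev -sder_slie.
Qed.

Lemma fl_homog_sum (I : finType) n (F : I -> L) :
  (forall i, fl_homog n (F i)) -> fl_homog n (\sum_i F i).
Proof.
by move=> HF; elim/big_ind: _ => //; [apply: Homog_0 | apply: Homog_add].
Qed.

Lemma fl_homogB n (u v : L) : fl_homog n u -> fl_homog n v -> fl_homog n (u - v).
Proof.
move=> hu hv; apply: Homog_add => //.
by rewrite -scaleN1r; apply: Homog_scale.
Qed.

Lemma matrix_der_homog A n z : fl_homog n z -> fl_homog n (matrix_der A z).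
Proof.
elim=> [x|m p u v hu Hu hv Hv|p|p u v _ Hu _ Hv|p k u _ Hu].
- rewrite /matrix_der fl_der_gen; apply: fl_homog_sum => y.
  exact/Homog_scale/Homog_gen.
- by rewrite matrix_derL; apply: Homog_add; apply: Homog_lie.
- by rewrite linear0; apply: Homog_0.
- by rewrite linearD; apply: Homog_add.
- by rewrite linearZ; apply: Homog_scale.
Qed.

Lemma expand_homog n z : fl_homog n z -> series_homog n (expand z).
Proof.
elim=> [x|m p u v hu Hu hv Hv|p|p u v _ Hu _ Hv|p k u _ Hu] w sw.
- by rewrite expand_gen /letter; case: eqP => // wx; rewrite wx in sw.
- rewrite expandL lie_seriesE slieE.
  have sw' : size w != (p + m)%N by rewrite addnC.
  by rewrite (smul_homog Hu Hv sw) (smul_homog Hv Hu sw') subrr.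
- by rewrite linear0.
- by rewrite linearD /= seriesD Hu // Hv // addr0.
- by rewrite linearZ /= seriesZ Hu // mulr0.
Qed.

Lemma fl_homog0 (z : L) : fl_homog 0 z -> z = 0.
Proof.
have H0 n (v : L) : fl_homog n v -> n = 0%N -> v = 0.
  elim=> {n v} [x|m n u v _ Hu _ _|n|n u v _ Hu _ Hv|n k u _ Hu] //.
  - by move/eqP; rewrite addn_eq0 => /andP[/eqP/Hu -> _]; rewrite lie0l.
  - by move=> n0; rewrite Hu // Hv // addr0.
  - by move=> n0; rewrite Hu // scaler0.
by move/H0; apply.
Qed.

Definition bracket_word (z : L) (w : seq X) : L :=
  foldl (fun v x => lie v (gen x)) z w.

Arguments bracket_word : simpl never.

Lemma bracket_word_cons z x w :
  bracket_word z (x :: w) = bracket_word (lie z (gen x)) w.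
Proof. by []. Qed.

Lemma bracket_wordZ k z w : bracket_word (k *: z) w = k *: bracket_word z w.
Proof.
by elim: w z => //= x w IH z; rewrite !bracket_word_cons lieZl IH.
Qed.

Lemma bracket_word_homog m z w :
  fl_homog m z -> fl_homog (m + size w) (bracket_word z w).
Proof.
elim: w m z => [|x w IH] m z hz /=; first by rewrite addn0.
by rewrite bracket_word_cons -addSnnS -addn1; apply/IH/Homog_lie/Homog_gen.
Qed.

(** The part of degree $n$ of the series $f$ acting on $z$ from the right
    through brackets: $\sum_{|w| = n} f(w) [\ldots[z, w_1], \ldots, w_n]$. *)
Fixpoint bracket_series n (z : L) f : L :=
  if n is m.+1 then \sum_x bracket_series m (lie z (gen x)) (lquo x f)
  else f [::] *: z.

Lemma bracket_series_linr n z : linear (bracket_series n z).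
Proof.
elim: n z => [|n IH] z k f g /=.
  by rewrite seriesD seriesZ scalerDl scalerA.
rewrite scaler_sumr -big_split; apply: eq_bigr => x _ /=.
by rewrite -IH.
Qed.
HB.instance Definition _ n z := GRing.isLinear.Build K series L _
  (bracket_series n z) (@bracket_series_linr n z).

Lemma bracket_series_linl n f : linear ((bracket_series n)^~ f).
Proof.
elim: n f => [|n IH] f k u v /=.
  by rewrite scalerDr !scalerA mulrC.
rewrite scaler_sumr -big_split; apply: eq_bigr => x _ /=.
by rewrite lieDl lieZl -IH.
Qed.

Lemma bracket_series0l n f : bracket_series n 0 f = 0.
Proof.
have /= := bracket_series_linl n f (-1) 0 0.
by rewrite scaler0 addr0 scaleN1r addNr.
Qed.

Lemma bracket_seriesZl n k z f :
  bracket_series n (k *: z) f = k *: bracket_series n z f.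
Proof.
have /= := bracket_series_linl n f k z 0.
by rewrite !addr0 bracket_series0l addr0.
Qed.

Lemma bracket_series_suml n f (F : X -> L) :
  bracket_series n (\sum_x F x) f = \sum_x bracket_series n (F x) f.
Proof.
apply: (big_morph (fun z => bracket_series n z f)) => [u v|].
  by have /= := bracket_series_linl n f 1 u v; rewrite !scale1r.
exact: bracket_series0l.
Qed.

Lemma bracket_series_mul m n z f g : series_homog m f ->
  bracket_series (m + n) z (smul f g) =
  bracket_series n (bracket_series m z f) g.
Proof.
elim: m z f => [|m IH] z f hf.
  have -> : smul f g = f [::] *: g.
    apply/funext => -[|x u] //.
    rewrite smul_consE (_ : lquo x f = 0) ?smul0l ?addr0 //.
    by apply/funext => v; apply: hf.
  by rewrite add0n linearZ /= bracket_seriesZl.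
rewrite addSn /= bracket_series_suml; apply: eq_bigr => x _.
by rewrite lquo_smul (hf [::]) // scale0r add0r IH //; apply: lquo_homog.
Qed.

(** Since bracketing on the right is an action of the associative algebra of
    series, the series of a Lie element acts as the bracket with that element;
    this is the Jacobi identity read as $\mathrm{ad}$ being a morphism. *)
Lemma bracket_series_expand n z v :
  fl_homog n v -> bracket_series n z (expand v) = lie z v.
Proof.
move=> hv; elim: hv z => {n v}
  [x|m p u v hu Hu hv Hv|p|p u v _ Hu _ Hv|p k u _ Hu] z.
- rewrite /= (bigD1 x) //= expand_gen big1 => [|y /negbTE yx].
    by rewrite lquo_letter eqxx scale1r addr0 [sone _]/(1%:R) scale1r.
  by rewrite lquo_letter yx scale0r scale0r.
- rewrite expandL lie_seriesE linearB /=.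
  rewrite bracket_series_mul; last exact: expand_homog.
  rewrite [in X in _ - X]addnC bracket_series_mul; last exact: expand_homog.
  rewrite Hu Hv Hv Hu.
  have /eqP := lie_jacobi z u v; rewrite -addrA addr_eq0 => /eqP ->.
  have lieN (x y : L) : lie x (- y) = - lie x y.
    by rewrite -scaleN1r lieZr scaleN1r.
  rewrite (lieC v (lie z u)) (lieC u (lie z v)) (lieC z v).
  by rewrite !lieN opprD !opprK addrC.
- by rewrite linear0 lie0r linear0.
- by rewrite !linearD /= Hu Hv lieDr.
- by rewrite !linearZ /= Hu lieZr.
Qed.

Definition dynkin n f : L :=
  if n is m.+1 then \sum_x bracket_series m (gen x) (lquo x f) else 0.

Lemma dynkin_linear n : linear (dynkin n).
Proof.
case: n => [|n] k f g /=; first by rewrite scaler0 addr0.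
rewrite scaler_sumr -big_split; apply: eq_bigr => x _ /=.
by rewrite -bracket_series_linr.
Qed.
HB.instance Definition _ n := GRing.isLinear.Build K series L _
  (dynkin n) (@dynkin_linear n).

Lemma dynkin_mul m n f g : series_homog m.+1 f ->
  dynkin (m.+1 + n) (smul f g) = bracket_series n (dynkin m.+1 f) g.
Proof.
move=> hf; rewrite addSn /= bracket_series_suml; apply: eq_bigr => x _.
rewrite lquo_smul (hf [::]) // scale0r add0r bracket_series_mul //.
exact: lquo_homog.
Qed.

Arguments dynkin : simpl never.

(** The Dynkin-Specht-Wever theorem.  By [dynkin_mul] and
    [bracket_series_expand], $v \mapsto D(\mathrm{expand}(v))$ sends $[u, v]$
    to $[Du, v] - [Dv, u] = [Du, v] + [u, Dv]$, so it is the derivation that is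
    the identity on generators. *)
Theorem dynkin_expand n v : fl_homog n v -> dynkin n (expand v) = n%:R *: v.
Proof.
elim=> {n v} [x|m p u v hu Hu hv Hv|p|p u v _ Hu _ Hv|p k u _ Hu].
- rewrite scale1r /dynkin /= (bigD1 x) //= expand_gen big1 => [|y /negbTE yx].
    by rewrite lquo_letter eqxx scale1r addr0 [sone _]/(1%:R) scale1r.
  by rewrite lquo_letter yx scale0r scale0r.
- case: m p hu Hu hv Hv => [|m] [|p] hu Hu hv Hv;
    try by [rewrite (fl_homog0 hu) lie0l linear0 scaler0 linear0
           |rewrite (fl_homog0 hv) lie0r linear0 scaler0 linear0].
  rewrite expandL lie_seriesE linearB /=.
  rewrite dynkin_mul; last exact: expand_homog.
  rewrite [in X in _ - X]addnC dynkin_mul; last exact: expand_homog.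
  rewrite Hu Hv !bracket_series_expand // !lieZl (lieC u v) scalerN opprK.
  by rewrite natrD scalerDl.
- by rewrite linear0 linear0 scaler0.
- by rewrite linearD linearD /= Hu Hv scalerDr.
- by rewrite linearZ linearZ /= Hu !scalerA mulrC.
Qed.

Theorem expand_inj n v :
  n%:R != 0 :> K -> fl_homog n v -> expand v = 0 -> v = 0.
Proof.
move=> n0 hv v0; have /eqP := dynkin_expand hv.
by rewrite v0 linear0 eq_sym scaler_eq0 (negbTE n0) => /eqP.
Qed.

Section LinearPredicate.
Variable Q : L -> Prop.
Hypotheses (Q0 : Q 0) (QD : forall u v, Q u -> Q v -> Q (u + v))
           (QZ : forall k u, Q u -> Q (k *: u)).

Lemma bracket_series_ind n z f :
  (forall w, size w = n -> f w != 0 -> Q (bracket_word z w)) ->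
  Q (bracket_series n z f).
Proof.
elim: n z f => [|n IH] z f H /=.
  have [->|f0] := eqVneq (f [::]) 0; first by rewrite scale0r.
  exact/QZ/(H [::]).
elim/big_ind: _ => // x _; apply: IH => w sw fw.
by apply: (H (x :: w)) => //=; rewrite sw.
Qed.

Lemma dynkin_ind n f :
  (forall x w, size w = n -> f (x :: w) != 0 -> Q (bracket_word (gen x) w)) ->
  Q (dynkin n.+1 f).
Proof.
move=> H; rewrite /dynkin; elim/big_ind: _ => // x _.
by apply: bracket_series_ind => w; apply: H.
Qed.

End LinearPredicate.

End Expansion.

(** * Integer noncommutative polynomials, for computation *)

Definition nat_of_abc (x : abc) : nat :=
  match x with ga => 0 | gb => 1 | gc => 2 end.
Definition abc_of_nat (n : nat) : abc :=
  match n with 0 => ga | 1 => gb | _ => gc end.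
Lemma nat_of_abcK : cancel nat_of_abc abc_of_nat. Proof. by case. Qed.
HB.instance Definition _ := Countable.copy abc (can_type nat_of_abcK).
Lemma abc_enumP : Finite.axiom [:: ga; gb; gc]. Proof. by case. Qed.
HB.instance Definition _ := isFinite.Build abc abc_enumP.

Lemma sum_abc (V : nmodType) (F : abc -> V) :
  \sum_x F x = F ga + F gb + F gc.
Proof.
have E : index_enum abc = [:: ga; gb; gc].
  by rewrite [index_enum _]unlock Finite.enum.unlock.
by rewrite E !big_cons big_nil addr0 addrA.
Qed.

(** A polynomial is a ternary trie: its constant term and its left quotients
    by the three letters. *)
Inductive ncpoly := NC0 | NC (k : Z) (ta tb tc : ncpoly).

Definition branch (x : abc) (t : ncpoly) : ncpoly :=
  if t is NC _ ta tb tc then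
    match x with ga => ta | gb => tb | gc => tc end
  else NC0.

Fixpoint nc_coef (t : ncpoly) (w : seq abc) : Z :=
  if w is x :: u then nc_coef (branch x t) u
  else if t is NC k _ _ _ then k else Z0.

Fixpoint nc_add (s t : ncpoly) : ncpoly :=
  match s, t with
  | NC0, _ => t
  | _, NC0 => s
  | NC k sa sb sc, NC l ta tb tc =>
      NC (Z.add k l) (nc_add sa ta) (nc_add sb tb) (nc_add sc tc)
  end.

Fixpoint nc_map (f : Z -> Z) (t : ncpoly) : ncpoly :=
  if t is NC l ta tb tc then
    NC (f l) (nc_map f ta) (nc_map f tb) (nc_map f tc)
  else NC0.

Definition nc_scale (k : Z) (t : ncpoly) : ncpoly :=
  if k is Z0 then NC0 else nc_map (Z.mul k) t.
Arguments nc_scale : simpl never.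

Fixpoint nc_mul (s t : ncpoly) : ncpoly :=
  if s is NC k sa sb sc then
    nc_add (nc_scale k t) (NC Z0 (nc_mul sa t) (nc_mul sb t) (nc_mul sc t))
  else NC0.

Definition nc_lie s t := nc_add (nc_mul s t) (nc_scale (Z.neg 1) (nc_mul t s)).

(** Pruning empty nodes keeps the tries as small as the supports of the
    polynomials when derivations are iterated. *)
Definition nc_node (k : Z) (ta tb tc : ncpoly) : ncpoly :=
  match k, ta, tb, tc with
  | Z0, NC0, NC0, NC0 => NC0
  | _, _, _, _ => NC k ta tb tc
  end.
Arguments nc_node : simpl never.

Fixpoint nc_der (A : abc -> abc -> Z) (t : ncpoly) : ncpoly :=
  if t is NC _ ta tb tc then
    let first x := nc_add (nc_scale (A ga x) ta)
      (nc_add (nc_scale (A gb x) tb) (nc_scale (A gc x) tc)) in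
    nc_node Z0 (nc_add (nc_der A ta) (first ga))
      (nc_add (nc_der A tb) (first gb)) (nc_add (nc_der A tc) (first gc))
  else NC0.

Fixpoint nc_is0 (t : ncpoly) : bool :=
  if t is NC k ta tb tc then
    if k is Z0 then [&& nc_is0 ta, nc_is0 tb & nc_is0 tc] else false
  else true.

Definition nc_letter (x : abc) : ncpoly :=
  let one := NC (Z.pos 1) NC0 NC0 NC0 in
  match x with
  | ga => NC Z0 one NC0 NC0
  | gb => NC Z0 NC0 one NC0
  | gc => NC Z0 NC0 NC0 one
  end.

Section Denotation.
Variable K : fieldType.

Definition Zr (k : Z) : K := (int_of_Z k)%:~R.

Lemma ZrD k l : Zr (Z.add k l) = Zr k + Zr l.
Proof. by rewrite /Zr -intrD -rmorphD. Qed.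
Lemma ZrM k l : Zr (Z.mul k l) = Zr k * Zr l.
Proof. by rewrite /Zr -intrM -rmorphM. Qed.
Lemma ZrN k : Zr (Z.opp k) = - Zr k.
Proof. by rewrite /Zr -rmorphN -rmorphN. Qed.
Lemma Zr_nat n : Zr (Z.of_nat n) = n%:R.
Proof.
rewrite /Zr (_ : int_of_Z _ = n) //.
by case: n => //= n; rewrite SuccNat2Pos.id_succ.
Qed.

Definition denote (t : ncpoly) : series K abc := fun w => Zr (nc_coef t w).

Lemma lquo_denote x t : lquo x (denote t) = denote (branch x t).
Proof. by []. Qed.

Lemma nc_coef0 w : nc_coef NC0 w = Z0.
Proof. by elim: w => // x u IH; case: x. Qed.

Lemma denote0 : denote NC0 = 0.
Proof. by apply/funext => w; rewrite /denote nc_coef0. Qed.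

Lemma denote_node k ta tb tc :
  denote (nc_node k ta tb tc) = denote (NC k ta tb tc).
Proof.
case: k ta tb tc => [|k|k] [|? ? ? ?] [|? ? ? ?] [|? ? ? ?] //.
apply/funext => -[|x u] //.
by case: x; rewrite /denote /= !nc_coef0.
Qed.

Lemma denote_add s t : denote (nc_add s t) = denote s + denote t.
Proof.
apply/funext => w; rewrite seriesD.
elim: w s t => [|x u IH] [|k sa sb sc] [|l ta tb tc];
  rewrite ?denote0 ?add0r ?addr0 //.
  exact: ZrD.
by case: x; apply: IH.
Qed.

Lemma denote_scale k t : denote (nc_scale k t) = Zr k *: denote t.
Proof.
have -> : denote (nc_scale k t) = denote (nc_map (Z.mul k) t).
  case: k => // /=; apply/funext => w; rewrite denote0.
  elim: w t => [|x u IH] [|l ta tb tc]; rewrite ?denote0 //.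
  by case: x; apply: IH.
apply/funext => w; rewrite seriesZ.
elim: w t => [|x u IH] [|l ta tb tc]; rewrite /= ?denote0 ?mulr0 //.
  exact: ZrM.
by case: x; apply: IH.
Qed.

Lemma denote_mul s t : denote (nc_mul s t) = smul (denote s) (denote t).
Proof.
apply/funext => w.
elim: w s => [|x u IH] [|k sa sb sc]; rewrite ?denote0 ?smul0l //.
  rewrite [nc_mul _ _]/= denote_add denote_scale seriesD seriesZ.
  by rewrite [X in _ + X](_ : _ = 0) ?addr0.
rewrite [nc_mul _ _]/= denote_add denote_scale seriesD seriesZ smul_consE.
by congr (_ + _); case: x; rewrite -IH.
Qed.

Lemma denote_lie s t : denote (nc_lie s t) = lie (denote s) (denote t).
Proof.
by rewrite denote_add denote_scale !denote_mul [Zr _]/(-1) scaleN1r.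
Qed.

Lemma denote_der A t :
  denote (nc_der A t) = sder (fun y x => Zr (A y x)) (denote t).
Proof.
apply/funext => w.
elim: w t => [|x u IH] [|k ta tb tc]; rewrite ?denote0 ?linear0 //.
  by rewrite [nc_der _ _]/= denote_node.
have E t y : denote t (y :: u) = denote (branch y t) u by [].
rewrite sder_consE sum_abc lquo_denote -IH [nc_der _ _]/= denote_node !E.
by case: x; rewrite [branch _ _]/= !denote_add !denote_scale !seriesD !seriesZ
  !addrA.
Qed.

Lemma denote_is0 t : nc_is0 t -> denote t = 0.
Proof.
move=> H; apply/funext => w; rewrite /denote (_ : nc_coef t w = Z0) //.
elim: t w H => [|[]//= ta IHa tb IHb tc IHc] w; first by rewrite nc_coef0.
by case: w => [|[] w] //= /and3P[Ha Hb Hc]; [apply: IHa|apply: IHb|apply: IHc].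
Qed.

Lemma denote_letter x : denote (nc_letter x) = letter K x.
Proof.
apply/funext => w; rewrite /denote /letter.
have -> : nc_coef (nc_letter x) w = if w == [:: x] then Z.pos 1 else Z0.
  by case: x; case: w => [|[] [|[] w]] //=; rewrite ?nc_coef0.
by case: ifP.
Qed.

End Denotation.

(** * Lie expressions and the data of the five elements *)

Inductive lexpr :=
| LGen of abc
| LAdd of lexpr & lexpr
| LOpp of lexpr
| LMul of nat & lexpr
| LBr of lexpr & lexpr.

Fixpoint leval (K : fieldType) (M : lieAlgType K) (g : abc -> M) e : M :=
  match e with
  | LGen x => g x
  | LAdd e f => leval g e + leval g f
  | LOpp e => - leval g e
  | LMul n e => n%:R *: leval g e
  | LBr e f => lie (leval g e) (leval g f)
  end.

Fixpoint nc_eval e : ncpoly :=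
  match e with
  | LGen x => nc_letter x
  | LAdd e f => nc_add (nc_eval e) (nc_eval f)
  | LOpp e => nc_scale (Z.neg 1) (nc_eval e)
  | LMul n e => nc_scale (Z.of_nat n) (nc_eval e)
  | LBr e f => nc_lie (nc_eval e) (nc_eval f)
  end.

Fixpoint ldegree e : option nat :=
  match e with
  | LGen _ => Some 1%N
  | LAdd e f => let d := ldegree e in if d == ldegree f then d else None
  | LOpp e | LMul _ e => ldegree e
  | LBr e f =>
      if (ldegree e, ldegree f) is (Some m, Some n) then Some (m + n)%N
      else None
  end.

Definition left_normed (x : abc) (u : seq abc) : lexpr :=
  foldl (fun e y => LBr e (LGen y)) (LGen x) u.

Section LieExpressions.
Variable K : fieldType.
Local Notation gen := (@fl_gen K abc).

Lemma leval_expand e : expand (leval gen e) = denote K (nc_eval e).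
Proof.
elim: e => [x|e IHe f IHf|e IHe|n e IHe|e IHe f IHf] /=.
- by rewrite expand_gen denote_letter.
- by rewrite linearD denote_add /= IHe IHf.
- by rewrite linearN denote_scale [Zr _ _]/(-1) scaleN1r /= IHe.
- by rewrite linearZ denote_scale Zr_nat /= IHe.
- by rewrite expandL denote_lie IHe IHf.
Qed.

Lemma leval_homog e n : ldegree e = Some n -> fl_homog n (leval gen e).
Proof.
elim: e n => [x|e IHe f IHf|e IHe|m e IHe|e IHe f IHf] n /=.
- by case=> <-; apply: Homog_gen.
- case: eqP => // ef en; apply: Homog_add; first exact: IHe.
  by apply: IHf; rewrite -ef.
- by rewrite -scaleN1r => /IHe/Homog_scale.
- by move=> /IHe/Homog_scale.
- case: (ldegree e) IHe => // p IHe; case: (ldegree f) IHf => // q IHf [<-].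
  by apply: Homog_lie; [apply: IHe|apply: IHf].
Qed.

Lemma leval_left_normed x u :
  leval gen (left_normed x u) = bracket_word (gen x) u.
Proof.
rewrite /left_normed -[gen x]/(leval gen (LGen x)).
by elim: u (LGen x) => //= y u IH e; rewrite IH.
Qed.

End LieExpressions.

Ltac reify t :=
  lazymatch t with
  | ?u + ?v => let e := reify u in let f := reify v in constr:(LAdd e f)
  | - ?u => let e := reify u in constr:(LOpp e)
  | ?n%:R *: ?u => let e := reify u in constr:(LMul n e)
  | lie ?u ?v => let e := reify u in let f := reify v in constr:(LBr e f)
  | fl_gen _ ?x => constr:(LGen x)
  end.

Ltac reify_I7 t :=
  let t := eval cbv beta delta [I7_1 I7_2 I7_3 I7_4 I7_5] in t in
  let e := reify t in exact e.

(* The elements are read in the free Lie algebra over the rationals, only to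
   extract their syntax: their coefficients are integers. *)
Local Notation qa := (fl_gen rat ga).
Local Notation qb := (fl_gen rat gb).
Local Notation qc := (fl_gen rat gc).

Definition I7_exprs : 5.-tuple lexpr :=
  [tuple ltac:(reify_I7 (I7_1 qa qb qc)); ltac:(reify_I7 (I7_2 qa qb qc));
         ltac:(reify_I7 (I7_3 qa qb qc)); ltac:(reify_I7 (I7_4 qa qb qc));
         ltac:(reify_I7 (I7_5 qa qb qc))].

Lemma I7_elementsE (K : fieldType) (M : lieAlgType K) (g : abc -> M) :
  I7_elements (g ga) (g gb) (g gc) = map_tuple (leval g) I7_exprs.
Proof. exact/val_inj. Qed.

Local Open Scope Z_scope.

(** Five words on which the coefficients of the five elements form a
    unimodular matrix; the functionals are the columns of its inverse. *)
Definition dual_functionals : 5.-tuple (seq (Z * seq abc)) :=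
  let w1 := [:: gc; gb; ga; gb; gb; gb; gb] in
  let w2 := [:: gb; gb; gb; ga; gb; gb; gc] in
  let w3 := [:: gb; gb; ga; gc; ga; gb; gc] in
  let w4 := [:: gb; gb; gc; ga; ga; gc; gb] in
  let w5 := [:: gb; gc; gc; gb; ga; gb; ga] in
  [tuple [:: (-2, w1); (-1, w3); (1, w4); (-1, w5)];
         [:: (-4, w1); (-3, w2); (-2, w4); (1, w5)];
         [:: (2, w1); (-1, w4)];
         [:: (-4, w1); (-1, w2)];
         [:: (1, w1)]].

Definition nc_pair (l : seq (Z * seq abc)) (t : ncpoly) : Z :=
  foldr (fun p s => Z.add (Z.mul p.1 (nc_coef t p.2)) s) Z0 l.

Definition raise_Z (y x : abc) : Z :=
  match y, x with gb, ga => -2 | gc, gb => 1 | _, _ => 0 end.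
Definition weight_Z (y x : abc) : Z :=
  match y, x with ga, ga => 2 | gc, gc => -2 | _, _ => 0 end.
Definition lower_Z (y x : abc) : Z :=
  match y, x with ga, gb => -1 | gb, gc => 2 | _, _ => 0 end.

(** The numbers $6!\,7!/(n!(n+1)!)$ for $n = 0, \ldots, 6$: the coefficients
    of the extremal projector, up to sign and a common denominator. *)
Definition extremal_coefs : seq Z :=
  [:: 3628800; 1814400; 302400; 25200; 1260; 42; 1].

Local Close Scope Z_scope.

Fixpoint weight (w : seq abc) : Z :=
  if w is x :: u then Z.add (weight u) (weight_Z x x) else Z0.

Section WeightAndPairing.
Variable K : fieldType.

Lemma sder_weight f w :
  sder (fun y x => Zr K (weight_Z y x)) f w = Zr K (weight w) * f w.
Proof.
elim: w f => [|x u IH] f; first by rewrite sder_nil mul0r.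
rewrite sder_consE IH [weight _]/= ZrD mulrDl; congr (_ + _).
rewrite (bigD1 x) //= big1 ?addr0 // => y.
by case: x; case: y => // _; rewrite mul0r.
Qed.

Definition pair_series (l : seq (Z * seq abc)) (f : series K abc) : K :=
  \sum_(p <- l) Zr K p.1 * f p.2.

Lemma pair_series_linear l : linear (pair_series l : series K abc -> K^o).
Proof.
move=> k f g; rewrite /pair_series scaler_sumr -big_split.
apply: eq_bigr => p _ /=; rewrite seriesD seriesZ mulrDr; congr (_ + _).
exact: mulrCA.
Qed.
HB.instance Definition _ l := GRing.isLinear.Build K (series K abc) K^o _
  (pair_series l) (@pair_series_linear l).

Lemma pair_series_denote l t : pair_series l (denote K t) = Zr K (nc_pair l t).
Proof.
rewrite /pair_series; elim: l => [|p l IH]; first by rewrite big_nil.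
by rewrite big_cons IH /= ZrD ZrM.
Qed.

End WeightAndPairing.

(** * The extremal projector *)

Fixpoint nc_extremal (cs : seq Z) (t : ncpoly) : ncpoly :=
  if cs is c :: cs' then
    nc_add (nc_scale c t)
      (nc_scale (Z.neg 1) (nc_der lower_Z (nc_extremal cs' (nc_der raise_Z t))))
  else NC0.

Section Extremal.
Variable K : fieldType.
Local Notation L := (freeLie K abc).

Definition int_der (A : abc -> abc -> Z) : L -> L :=
  matrix_der (fun y x => Zr K (A y x)).
HB.instance Definition _ A := GRing.Linear.on (int_der A).

Lemma expand_int_der A v t : expand v = denote K t ->
  expand (int_der A v) = denote K (nc_der A t).
Proof. by move=> vt; rewrite expand_matrix_der vt denote_der. Qed.

(** The operator $\sum_n (-1)^n c_n y^n x^n$, in Horner form; its value at an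
    element killed by $x$ is therefore a multiple of that element. *)
Fixpoint extremal (cs : seq Z) (v : L) : L :=
  if cs is c :: cs' then
    Zr K c *: v - int_der lower_Z (extremal cs' (int_der raise_Z v))
  else 0.

Lemma extremal_linear cs : linear (extremal cs).
Proof.
elim: cs => [|c cs IH] k u v /=; first by rewrite scaler0 addr0.
rewrite (linearP (int_der raise_Z)) IH (linearP (int_der lower_Z)).
rewrite scalerDr scalerBr !scalerA mulrC opprD.
by rewrite addrACA.
Qed.
HB.instance Definition _ cs := GRing.isLinear.Build K L L _ (extremal cs)
  (@extremal_linear cs).

Lemma extremal_id c cs v :
  int_der raise_Z v = 0 -> extremal (c :: cs) v = Zr K c *: v.
Proof. by move=> rv; rewrite /= rv !(linear0, subr0). Qed.

Lemma extremal_homog cs n v : fl_homog n v -> fl_homog n (extremal cs v).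
Proof.
elim: cs v => [|c cs IH] v hv /=; first exact: Homog_0.
apply: fl_homogB; first exact: Homog_scale.
exact/matrix_der_homog/IH/matrix_der_homog.
Qed.

Lemma expand_extremal cs v t : expand v = denote K t ->
  expand (extremal cs v) = denote K (nc_extremal cs t).
Proof.
elim: cs v t => [|c cs IH] v t vt /=; first by rewrite linear0 denote0.
rewrite linearB linearZ /= denote_add !denote_scale vt [Zr _ (Z.neg 1)]/(-1).
rewrite scaleN1r (@expand_int_der _ _ (nc_extremal cs (nc_der raise_Z t))) //.
exact/IH/expand_int_der.
Qed.

End Extremal.

Arguments extremal : simpl never.

(** * The span of the projected brackets, by computation *)

(** What is left of [t] after its only candidate expression in terms of the
    polynomials of [J] is subtracted, when [J] pairs each of these polynomials
    with its dual functional. *)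
Definition nc_remainder (J : seq (seq (Z * seq abc) * ncpoly)) (t : ncpoly) :
    ncpoly :=
  foldr (fun p s => nc_add (nc_scale (Z.opp (nc_pair p.1 t)) p.2) s) t J.

Lemma denote_remainder (K : fieldType) J t : denote K (nc_remainder J t) =
  denote K t - \sum_(p <- J) Zr K (nc_pair p.1 t) *: denote K p.2.
Proof.
elim: J => [|p J IH] /=; first by rewrite big_nil subr0.
rewrite big_cons denote_add denote_scale IH ZrN.
by rewrite scaleNr opprD addrCA addrA.
Qed.

Fixpoint forall_words (n : nat) (p : seq abc -> bool) : bool :=
  if n is m.+1 then
    [&& forall_words m (fun u => p (ga :: u)),
        forall_words m (fun u => p (gb :: u))
      & forall_words m (fun u => p (gc :: u))]
  else p [::].

Lemma forall_wordsP n p w : forall_words n p -> size w = n -> p w.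
Proof.
elim: n p w => [|n IH] p [|x u] //= /and3P[pa pb pc] [su].
by case: x; [apply: (IH _ _ pa)|apply: (IH _ _ pb)|apply: (IH _ _ pc)].
Qed.

Definition I7_data := zip_tuple dual_functionals (map_tuple nc_eval I7_exprs).

Definition extremal_in_span J (w : seq abc) : bool :=
  if weight w is Z0 then
    if w is x :: y :: u then
      (nat_of_abc x <= nat_of_abc y)%N ||
      nc_is0 (nc_remainder J (nc_extremal extremal_coefs
                                (nc_eval (left_normed x (y :: u)))))
    else false
  else true.

(* The binding makes the five polynomials be computed once, not once per
   word. *)
Definition check_span : bool :=
  let J := tval I7_data in forall_words 7 (extremal_in_span J).

Lemma check_span_true : check_span.
Proof. by vm_cast_no_check (erefl true). Qed.

Lemma big_zip_tuple (V : nmodType) (S T : Type) n (s : n.-tuple S)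
    (t : n.-tuple T) (F : S * T -> V) :
  \sum_(p <- zip s t) F p = \sum_(i < n) F (tnth s i, tnth t i).
Proof.
case: n s t => [|n] s t.
  by rewrite (tuple0 s) (tuple0 t) big_nil big_ord0.
pose x0 := (thead s, thead t).
rewrite (big_nth x0) big_mkord size_tuple; apply: eq_bigr => i _.
by rewrite nth_zip ?size_tuple // -!tnth_nth.
Qed.

(** * The invariants of degree 7 *)

Section Invariants.
Variable R : realType.
Local Notation C := R[i].
Local Notation L := (freeLie C abc).
Local Notation gen := (@fl_gen C abc).

Lemma Zr_eq0 k : (Zr C k == 0) = (k == Z0).
Proof. by rewrite intr_eq0 -[RHS](inj_eq (can_inj int_of_ZK)). Qed.

HB.instance Definition _ D := GRing.isLinear.Build C L L _ (act D)
  (act_derivation D).1.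

Lemma act_int_der D A :
  (forall y, act D (gen y) = \sum_x Zr C (A y x) *: gen x) ->
  act D = @int_der C A.
Proof. exact: fl_der_unique (act_derivation _). Qed.

Lemma act_raise : act (sl2x R) = @int_der C raise_Z.
Proof.
apply: act_int_der => y; rewrite sum_abc.
case: y; rewrite ?act_xa ?act_xb ?act_xc [raise_Z _]/= [Zr _ Z0]/(0).
- by rewrite !scale0r !addr0.
- by rewrite !scale0r !addr0.
- by rewrite !scale0r addr0 add0r [Zr _ _]/(1) scale1r.
Qed.

Lemma act_weight : act (sl2h R) = @int_der C weight_Z.
Proof.
apply: act_int_der => y; rewrite sum_abc.
case: y; rewrite ?act_ha ?act_hb ?act_hc [weight_Z _]/= [Zr _ Z0]/(0).
- by rewrite !scale0r !addr0.
- by rewrite !scale0r !addr0.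
- by rewrite !scale0r !add0r.
Qed.

Lemma act_lower : act (sl2y R) = @int_der C lower_Z.
Proof.
apply: act_int_der => y; rewrite sum_abc.
case: y; rewrite ?act_ya ?act_yb ?act_yc [lower_Z _]/= [Zr _ Z0]/(0).
- by rewrite !scale0r addr0 add0r [Zr _ _]/(-1) scaleN1r.
- by rewrite !scale0r !add0r.
- by rewrite !scale0r !addr0.
Qed.

Lemma act_linear k D D' (z : L) : act (k *: D + D') z = k *: act D z + act D' z.
Proof.
elim/freeLie_ind: z => [x||u v Eu Ev|a u Eu|u v Eu Ev].
- rewrite /act !fl_der_gen /sl2_gen.
  have E i j : mxcomm (k *: D + D') (gen_sl2 R x) i j =
      k * mxcomm D (gen_sl2 R x) i j + mxcomm D' (gen_sl2 R x) i j.
    by rewrite !mxcommE !mxE; ring.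
  rewrite !E !scalerDl !scalerDr !scalerA.
  by rewrite (AC (2*2*2) ((1*3*5)*(2*4*6))).
- by rewrite !(linear0, scaler0, addr0).
- by rewrite !(linearD (act _)) /= Eu Ev scalerDr addrACA.
- rewrite !(linearZ_LR (act _)) /= Eu scalerDr !scalerA; congr (_ *: _ + _).
  exact: mulrC.
- rewrite (act_derivation _).2 Eu Ev (act_derivation D).2 (act_derivation D').2.
  by rewrite lieDl lieDr lieZl lieZr scalerDr addrACA.
Qed.

Lemma sl2x_in : sl2 (sl2x R).
Proof. by rewrite /sl2 /= /mxtrace !big_ord_recl big_ord0 !mxE /= !addr0. Qed.

Lemma sl2h_in : sl2 (sl2h R).
Proof.
rewrite /sl2 /= /mxtrace !big_ord_recl big_ord0 !mxE /=.
by rewrite subr0 sub0r addr0 subrr.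
Qed.

Lemma act_sl2_eq0 D (z : L) : sl2 D ->
  act (sl2x R) z = 0 -> act (sl2h R) z = 0 -> act (sl2y R) z = 0 -> act D z = 0.
Proof.
move=> /sl2_span -> xz hz yz.
have a0 : act 0 z = 0.
  by have := act_linear (-1) 0 0 z; rewrite scaler0 addr0 scaleN1r addNr.
by rewrite -[_ *: sl2y R]addr0 -addrA !act_linear xz hz yz a0 !scaler0 !addr0.
Qed.

Lemma tnth_I7 i : tnth (I7 R) i = leval gen (tnth I7_exprs i).
Proof. by rewrite /I7 (I7_elementsE gen) tnth_map. Qed.

Lemma I7_homog i : fl_homog 7 (tnth (I7 R) i).
Proof.
rewrite tnth_I7; apply: leval_homog; apply/eqP.
have /all_tnthP : all (fun e => ldegree e == Some 7) I7_exprs by vm_compute.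
exact.
Qed.

Lemma expand_I7 i :
  expand (tnth (I7 R) i) = denote C (nc_eval (tnth I7_exprs i)).
Proof. by rewrite tnth_I7 leval_expand. Qed.

Definition nc_invariant t :=
  [&& nc_is0 (nc_der raise_Z t), nc_is0 (nc_der weight_Z t)
    & nc_is0 (nc_der lower_Z t)].

Lemma I7_invariant i : lie_invariant R 7 (tnth (I7 R) i).
Proof.
split=> [|D sD]; first exact: I7_homog.
have /all_tnthP/(_ i) : all (fun e => nc_invariant (nc_eval e)) I7_exprs.
  by vm_compute.
have kill A : nc_is0 (nc_der A (nc_eval (tnth I7_exprs i))) ->
    int_der A (tnth (I7 R) i) = 0.
  move=> A0; apply: (@expand_inj _ _ 7); first by rewrite pnatr_eq0.
    exact/matrix_der_homog/I7_homog.
  by rewrite (expand_int_der _ (expand_I7 i)) denote_is0.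
case/and3P=> /kill xi /kill hi /kill yi.
by apply: act_sl2_eq0; rewrite ?act_raise ?act_weight ?act_lower.
Qed.

Lemma I7_dual i j :
  pair_series (tnth dual_functionals i) (expand (tnth (I7 R) j)) = (i == j)%:R.
Proof.
rewrite expand_I7 pair_series_denote !(tnth_nth [::]) !(tnth_nth (LGen ga)).
have /allP/(_ i) : all (fun i => all (fun j =>
    nc_pair (nth [::] dual_functionals i) (nc_eval (nth (LGen ga) I7_exprs j))
    == if i == j then Z.pos 1 else Z0) (iota 0 5)) (iota 0 5) by vm_compute.
rewrite mem_iota ltn_ord => /(_ isT) /allP/(_ j).
rewrite mem_iota ltn_ord => /(_ isT) /eqP ->.
by rewrite -val_eqE /=; case: eqP.
Qed.

Lemma I7_free (k : 'I_5 -> C) :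
  \sum_(i < 5) k i *: tnth (I7 R) i = 0 -> forall i, k i = 0.
Proof.
move=> k0 i.
have : pair_series (tnth dual_functionals i)
    (expand (\sum_(i < 5) k i *: tnth (I7 R) i)) = 0.
  by rewrite k0 !linear0.
rewrite !linear_sum (bigD1 i) //= big1 => [|j ji].
  by rewrite !linearZ /= I7_dual eqxx addr0 => <-; rewrite [RHS]mulr1.
by rewrite !linearZ /= I7_dual eq_sym (negbTE ji) [LHS]mulr0.
Qed.

Definition I7_span : set L :=
  [set v | exists k : 'I_5 -> C, v = \sum_(i < 5) k i *: tnth (I7 R) i]%classic.

Lemma I7_span0 : I7_span 0.
Proof. by exists (fun=> 0); rewrite big1 // => i _; rewrite scale0r. Qed.

Lemma I7_spanD u v : I7_span u -> I7_span v -> I7_span (u + v).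
Proof.
move=> [k ->] [l ->]; exists (fun i => k i + l i).
by rewrite -big_split; apply: eq_bigr => i _; rewrite scalerDl.
Qed.

Lemma I7_spanZ a u : I7_span u -> I7_span (a *: u).
Proof.
move=> [k ->]; exists (fun i => a * k i).
by rewrite scaler_sumr; apply: eq_bigr => i _; rewrite scalerA.
Qed.

Lemma nc_remainder_span v t : fl_homog 7 v -> expand v = denote C t ->
  nc_is0 (nc_remainder I7_data t) -> I7_span v.
Proof.
move=> hv vt /(denote_is0 C); rewrite denote_remainder.
rewrite big_zip_tuple -vt => vs.
exists (fun i => Zr C (nc_pair (tnth dual_functionals i) t)).
apply/eqP; rewrite -subr_eq0; apply/eqP; apply: (@expand_inj _ _ 7).
- by rewrite pnatr_eq0.
- apply: fl_homogB => //; apply: fl_homog_sum => i.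
  exact/Homog_scale/I7_homog.
rewrite linearB linear_sum -[RHS]vs; congr (_ - _).
by apply: eq_bigr => i _; rewrite linearZ /= tnth_map expand_I7.
Qed.

(** When the first two letters of a word are exchanged its bracket changes
    sign, so that the words checked by [check_span_true], in which the first
    letter comes after the second, account for all of them. *)
Lemma extremal_word_span x u : size u = 6 -> weight (x :: u) = Z0 ->
  I7_span (extremal extremal_coefs (bracket_word (gen x) u)).
Proof.
have descent y z v : (nat_of_abc z < nat_of_abc y)%N -> size v = 5 ->
    weight [:: y, z & v] = Z0 ->
    I7_span (extremal extremal_coefs (bracket_word (gen y) (z :: v))).
  move=> zy sv wt0.
  have : extremal_in_span I7_data [:: y, z & v].
    by apply: (forall_wordsP check_span_true); rewrite /= sv.
  rewrite /extremal_in_span wt0 leqNgt zy orFb; apply: nc_remainder_span.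
    apply: extremal_homog.
    by have := bracket_word_homog (z :: v) (Homog_gen C y); rewrite /= sv.
  apply: expand_extremal; rewrite -leval_left_normed.
  exact: leval_expand.
case: u => [|y u] su wt0; first discriminate su.
case: su => su; case: (ltngtP (nat_of_abc x) (nat_of_abc y)) => xy.
- rewrite bracket_word_cons (lieC (gen y)) -scaleN1r bracket_wordZ linearZ.
  apply: I7_spanZ; apply: descent => //; rewrite -wt0 /=.
  by rewrite -!Z.add_assoc (Z.add_comm (weight_Z x x)).
- exact: descent.
- rewrite bracket_word_cons (can_inj nat_of_abcK xy) liexx -(scale0r 0).
  by rewrite bracket_wordZ scale0r linear0; apply: I7_span0.
Qed.

Lemma invariant_span : (lie_invariant R 7 `<=` I7_span)%classic.
Proof.
move=> Z [hZ invZ].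
have xZ : @int_der C raise_Z Z = 0 by rewrite -act_raise; apply/invZ/sl2x_in.
have wZ : @int_der C weight_Z Z = 0 by rewrite -act_weight; apply/invZ/sl2h_in.
have supp w : expand Z w != 0 -> weight w = Z0.
  move=> Zw; have : expand (int_der weight_Z Z) w = 0 by rewrite wZ linear0.
  rewrite expand_matrix_der sder_weight => /eqP.
  by rewrite mulf_eq0 (negbTE Zw) orbF Zr_eq0 => /eqP.
have : I7_span (extremal extremal_coefs (dynkin 7 (expand Z))).
  apply: (@dynkin_ind _ _ (fun v => I7_span (extremal extremal_coefs v))).
  - by rewrite linear0; apply: I7_span0.
  - by move=> u v Qu Qv; rewrite linearD; apply: I7_spanD.
  - by move=> k u Qu; rewrite linearZ; apply: I7_spanZ.
  - by move=> x u su /supp; apply: extremal_word_span.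
rewrite (dynkin_expand hZ) extremal_id; last by rewrite linearZ /= xZ scaler0.
(* The leading coefficient is made abstract: as a multiple of one it would
   reduce to a unary number. *)
have: Zr C (head Z0 extremal_coefs) != 0 by rewrite Zr_eq0.
move: (Zr C _) => c c0.
rewrite scalerA => /(I7_spanZ (c * 7%:R)^-1).
by rewrite scalerA mulVf ?scale1r // mulf_neq0 // pnatr_eq0.
Qed.

End Invariants.

Theorem theorem22 (R : realType) :
  has_dim (lie_invariant R 7) 5 /\ is_basis (lie_invariant R 7) (I7 R).
Proof.
have basis : is_basis (lie_invariant R 7) (I7 R).
  split; first exact: I7_free.
  apply/seteqP; split; first exact: invariant_span.
  move=> _ [k ->]; split=> [|D sD].
    by apply: fl_homog_sum => i; apply/Homog_scale/I7_homog.
  rewrite linear_sum big1 // => i _.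
  by rewrite linearZ /= (I7_invariant R i).2 // scaler0.
by split=> //; exists (I7 R).
Qed.
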